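(* Let $\mathcal H$ be a complex Hilbert space of finite dimension $d\ge 2$, let $P$ be a nonzero orthogonal projection on $\mathcal H$, and let $\mathsf M,\mathsf N\in\mathfrak M_P$. Then the following are equivalent: (1) there exists $U\in G_P$ such that $U\mathsf M U^*=\mathsf N$; (2) $\lambda_P(\mathsf M)=\lambda_P(\mathsf N)$. Consequently, every nonempty set $\mathfrak M_{P,\lambda}$ is a single $G_P$-orbit, and the orbits of $G_P$ on $\mathfrak M_P$ are indexed by the integer partitions of $d-\operatorname{rank}P$ (via $\lambda\mapsto\mathfrak M_{P,\lambda}$).
   Context: A projective measurement on $\mathcal H$ is an unordered finite family (set) $\mathsf M=\{P_1,\dots,P_m\}$ of nonzero pairwise orthogonal orthogonal projections on $\mathcal H$ with $\sum_{j=1}^m P_j=I$; its elements are called outcomes. $\mathfrak M(\mathcal H)$ is the set of all projective measurements, and $\mathfrak M_P=\{\mathsf M\in\mathfrak M(\mathcal H):P\in\mathsf M\}$. $\mathcal U(\mathcal H)$ is the unitary group of $\mathcal H$. The complementary unitary group of $P$ is $G_P=\{U\in\mathcal U(\mathcal H):Ux=x\text{ for every }x\in\operatorname{ran}P\}$. It acts on $\mathfrak M_P$ by $U\cdot\mathsf M=U\mathsf M U^*:=\{UQU^*:Q\in\mathsf M\}$. For $P\in\mathsf M$, the complementary rank profile $\lambda_P(\mathsf M)=(r_1,\dots,r_k)$ is the nondecreasing tuple listing (with multiplicity) the ranks of the projections in $\mathsf M\setminus\{P\}$; it is an integer partition of $d-\operatorname{rank}P$ (the empty partition if $P=I$). For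 a profile $\lambda$, $\mathfrak M_{P,\lambda}=\{\mathsf M\in\mathfrak M_P:\lambda_P(\mathsf M)=\lambda\}$. *)

(* Defs.v *)
From HB Require Import structures.
From mathcomp Require Import all_boot all_order all_algebra finmap.
From mathcomp Require Import all_classical reals complex.

Set Implicit Arguments.
Unset Strict Implicit.
Unset Printing Implicit Defensive.

Import Order.TTheory GRing.Theory Num.Theory Num.Def.

Local Open Scope classical_set_scope.
Local Open Scope fset_scope.
Local Open Scope ring_scope.

(* A finite-dimensional complex Hilbert space is a vectType V over the complex
   numbers with an inner product f : {dot V for conjC}, which is linear in its
   first argument and conjugate-linear in the second one. Operators are the
   elements of 'End(V). *)

Section Hilbert.
Variables (C : numClosedFieldType) (V : vectType C) (f : {dot V for conjC}).
Implicit Types (A B P Q U : 'End(V)) (S : seq V) (M : {fset 'End(V)}).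

(* The default value 0 is never used: see adjointP and adjoint_unique. *)
Definition adjoint A : 'End(V) :=
  xget 0 [set B : 'End(V) | forall x y, f (A x) y = f x (B y)].

Lemma orthonormal_ext n : (n <= \dim {:V})%N ->
  exists2 S, size S = n & orthonormal f S.
Proof.
elim: n => [|n IHn] ltn; first by exists [::].
have [S sS oS] := IHn (ltnW ltn).
have [v vS] : exists v, v \notin <<S>>%VS.
  apply: contrapT => /forallNP all_S.
  have : ({:V} <= <<S>>)%VS.
    by apply/subvP => x _; move/negP/negPn: (all_S x).
  move=> /dimvS; rewrite leqNgt => /negP; apply.
  by apply: leq_ltn_trans (dim_span S) _; rewrite sS.
have [X memX [Y [defv _ YS]]] := orthogonal_split f S v.
have Y0 : Y != 0.
  by apply: contraNneq vS => Y0; rewrite defv Y0 addr0.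
have nY : 0 < f Y Y by rewrite dnorm_gt0.
pose e := (sqrtC (f Y Y))^-1 *: Y.
exists (e :: S); first by rewrite /= sS.
rewrite -cat1s orthonormal_cat oS /=; apply/andP; split.
  rewrite /orthonormal /= !andbT dnormZ normfV ger0_norm ?sqrtC_ge0 ?ltW //.
  by rewrite exprVn sqrtCK mulVf // gt_eqF.
apply/orthoPl => u uS.
by rewrite linearZl_LR /= [f Y u](orthoPl YS) ?mulr0.
Qed.

Lemma adjointP A x y : f (A x) y = f x (adjoint A y).
Proof.
have [S sS oS] := orthonormal_ext (leqnn _).
have fS := orthonormal_free oS.
have spanS : <<S>>%VS = fullv.
  by apply/eqP; rewrite eqEdim subvf /= -sS; move: fS; rewrite /free => /eqP->.
have [uS eS] := orthonormalP oS.
have defx (u : V) : u = \sum_(e <- S) f u e *: e.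
  have [X XS [Y [-> _ YS]]] := orthogonal_split f S u.
  have -> : Y = 0.
    apply/eqP; rewrite -(dnorm_eq0 f); apply/eqP.
    by apply: (span_orthogonal YS); rewrite ?spanS ?memvf ?memv_span1.
  rewrite addr0; move: XS => /(@coord_span _ _ _ (in_tuple S)) defX.
  rewrite {1}defX (big_nth 0) big_mkord; apply: eq_bigr => i _; congr (_ *: _).
  rewrite [in RHS]defX linear_sumlz (bigD1 i) //= big1 => [|j ji].
    by rewrite linearZl_LR /= eS ?mem_nth // eqxx mulr1 addr0.
  by rewrite linearZl_LR /= eS ?mem_nth // nth_uniq // [_ == _](negPf ji) mulr0.
have lin : linear (fun z : V => \sum_(e <- S) f z (A e) *: e).
  move=> a u w; rewrite scaler_sumr -big_split /=; apply: eq_bigr => e _.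
  by rewrite linearPl /= scalerDl scalerA.
pose hB := GRing.isLinear.Build _ _ _ _ _ lin.
pose B : {linear V -> V} := HB.pack (fun z : V => \sum_(e <- S) f z (A e) *: e) hB.
have : forall x y, f (A x) y = f x (linfun B y).
  move=> u w; rewrite lfunE /= {1}(defx u) linear_sum linear_sumlz linear_sumr.
  apply: eq_bigr => e _; rewrite linearZ linearZl_LR linearZr_LR /=.
  by rewrite (hermC f w) /= expr0 mul1r conjCK mulrC.
by move=> hA; move: x y; rewrite /adjoint; case: xgetP => [B' _ //| /(_ (linfun B))].
Qed.

Lemma adjoint_unique A B : (forall x y, f (A x) y = f x (B y)) -> B = adjoint A.
Proof.
move=> hB; apply/lfunP => y; apply/eqP; rewrite -subr_eq0 -(dnorm_eq0 f).
by rewrite linearBr /= -hB -adjointP subrr.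
Qed.

Definition orthoproj P := (P \o P)%VF = P /\ adjoint P = P.

Definition unitary U :=
  (adjoint U \o U)%VF = \1%VF /\ (U \o adjoint U)%VF = \1%VF.

Definition op_rank P : nat := \dim (limg P).

Definition measurements : set {fset 'End(V)} :=
  [set M : {fset 'End(V)} |
    [/\ forall Q, Q \in M -> orthoproj Q /\ Q <> 0,
        forall Q Q', Q \in M -> Q' \in M -> Q <> Q' -> (Q \o Q')%VF = 0 &
        \sum_(Q <- M) Q = \1%VF]].

Definition measurements_at P : set {fset 'End(V)} :=
  [set M : {fset 'End(V)} | measurements M /\ P \in M].

Definition comp_unitary P : set 'End(V) :=
  [set U : 'End(V) | unitary U /\ forall x, x \in limg P -> U x = x].

Definition conj_family U M : {fset 'End(V)} :=
  [fset (U \o Q \o adjoint U)%VF | Q in M].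

Definition rank_profile P M : seq nat :=
  sort leq [seq op_rank Q | Q <- M `\ P].

Definition measurements_profile P (lam : seq nat) : set {fset 'End(V)} :=
  [set M : {fset 'End(V)} | measurements_at P M /\ rank_profile P M = lam].

Definition orbit_of P M : set {fset 'End(V)} :=
  [set conj_family U M | U in comp_unitary P].

Definition orbits P : set (set {fset 'End(V)}) :=
  [set orbit_of P M | M in measurements_at P].

End Hilbert.

(* As for rank profiles, the parts are listed in nondecreasing order. *)
Definition integer_partitions (n : nat) : set (seq nat) :=
  [set lam : seq nat | [/\ sorted leq lam, 0%N \notin lam & sumn lam = n]].

(* Main.v *)
(* Choose an orthonormal basis of the range of every projection in M and in N.
   If the two families, with P removed from both, have the same ranks, matching
   the bases gives partial isometries between corresponding ranges; together
   with P on ran P, they add up to a unitary that fixes ran P and conjugates M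
   into N. Every partition of d - rank P is realized by splitting the range of
   I - P into orthogonal pieces of the prescribed dimensions. *)

From HB Require Import structures.
Require Import Defs.
From mathcomp Require Import all_boot all_order all_algebra finmap.
From mathcomp Require Import all_classical reals complex.

Set Implicit Arguments.
Unset Strict Implicit.
Unset Printing Implicit Defensive.

Import Order.TTheory GRing.Theory Num.Theory Num.Def.

Local Open Scope classical_set_scope.
Local Open Scope ring_scope.

Section HilbertTheory.
Variables (C : numClosedFieldType) (V : vectType C) (f : {dot V for conjC}).
Implicit Types (A B P Q U W : 'End(V)) (X : {vspace V}) (s t : seq 'End(V)).
Implicit Types (M N : {fset 'End(V)}).

Local Notation adj := (adjoint f).

(** * Composition with finite sums and the calculus of adjoints *)

Lemma comp_lfun_suml (I : Type) (r : seq I) (F : I -> 'End(V)) A :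
  (\sum_(i <- r) F i \o A)%VF = \sum_(i <- r) (F i \o A)%VF.
Proof.
apply/lfunP => x; rewrite comp_lfunE !sum_lfunE.
by under [RHS]eq_bigr do rewrite comp_lfunE.
Qed.

Lemma comp_lfun_sumr (I : Type) (r : seq I) (F : I -> 'End(V)) A :
  (A \o \sum_(i <- r) F i)%VF = \sum_(i <- r) (A \o F i)%VF.
Proof.
apply/lfunP => x; rewrite comp_lfunE !sum_lfunE linear_sum.
by under [RHS]eq_bigr do rewrite comp_lfunE.
Qed.

Lemma adjointE A B : (forall x y, f (A x) y = f x (B y)) -> adj A = B.
Proof. by move/adjoint_unique. Qed.

Lemma dotC x y : f x y = conjC (f y x).
Proof. by rewrite hermC expr0 mul1r. Qed.

Lemma adjointPr A x y : f x (A y) = f (adj A x) y.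
Proof. by rewrite dotC adjointP -dotC. Qed.

Lemma adjointK A : adj (adj A) = A.
Proof. by apply: adjointE => x y; rewrite -adjointPr. Qed.

Lemma adjoint_comp A B : adj (A \o B)%VF = (adj B \o adj A)%VF.
Proof. by apply: adjointE => x y; rewrite !comp_lfunE !adjointP. Qed.

Lemma adjointD A B : adj (A + B) = adj A + adj B.
Proof.
by apply: adjointE => x y; rewrite !add_lfunE linearDr linearDl /= !adjointP.
Qed.

Lemma adjointN A : adj (- A) = - adj A.
Proof.
by apply: adjointE => x y; rewrite !opp_lfunE linearNr linearNl /= !adjointP.
Qed.

Lemma adjoint1 : adj \1%VF = \1%VF.
Proof. by apply: adjointE => x y; rewrite !id_lfunE. Qed.

Lemma adjoint0 : adj 0 = 0.
Proof. by apply: adjointE => x y; rewrite !zero_lfunE linear0l linear0r. Qed.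

Lemma adjoint_sum (I : Type) (r : seq I) (F : I -> 'End(V)) :
  adj (\sum_(i <- r) F i) = \sum_(i <- r) adj (F i).
Proof. exact: (big_morph _ adjointD adjoint0). Qed.

(** * Orthonormal families *)

(** Indexing by ['I_n] lets two families of the same length be matched term by term, which is how
    partial isometries are built. *)
Definition onfam n (e : 'I_n -> V) := forall i j, f (e i) (e j) = (i == j)%:R.

Lemma onfam_nth n (S : seq V) : size S = n -> orthonormal f S ->
  onfam (fun i : 'I_n => S`_i).
Proof.
move=> sS /(orthonormalP (U := V)) [uS eS] i j.
by rewrite eS ?mem_nth ?sS // nth_uniq ?sS.
Qed.

(* Gram-Schmidt: normalise the component orthogonal to [S] of a vector of [X]
   outside [<<S>>]. *)
Lemma orthonormal_in X n : (n <= \dim X)%N ->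
  exists S, [/\ size S = n, orthonormal f S & {subset S <= X}].
Proof.
elim: n => [|n IHn] ltn; first by exists [::].
have [S [sS oS SX]] := IHn (ltnW ltn).
have [v vX vS] : exists2 v, v \in X & v \notin <<S>>%VS.
  apply: contrapT => all_S.
  have : (X <= <<S>>)%VS.
    apply/subvP => x xX; apply/negPn/negP => xS; apply: all_S.
    by exists x.
  move=> /dimvS; rewrite leqNgt => /negP; apply.
  by apply: leq_ltn_trans (dim_span S) _; rewrite sS.
have [Z memZ [Y [defv _ YS]]] := orthogonal_split f S v.
have Y0 : Y != 0.
  by apply: contraNneq vS => Y0; rewrite defv Y0 addr0.
have YX : Y \in X.
  have -> : Y = v - Z by rewrite defv addrAC subrr add0r.
  by rewrite memvB //; apply: subvP memZ; apply/span_subvP.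
have nY : 0 < f Y Y by rewrite dnorm_gt0.
pose e := (sqrtC (f Y Y))^-1 *: Y.
exists (e :: S); split; first by rewrite /= sS.
  rewrite -cat1s orthonormal_cat oS /=; apply/andP; split.
    rewrite /orthonormal /= !andbT dnormZ normfV ger0_norm ?sqrtC_ge0 ?ltW //.
    by rewrite exprVn sqrtCK mulVf // gt_eqF.
  apply/orthoPl => u uS.
  by rewrite linearZl_LR /= [f Y u](orthoPl YS) ?mulr0.
by move=> u; rewrite inE => /orP[/eqP-> | /SX //]; rewrite memvZ.
Qed.

(** * Operators built from two families of vectors *)

Section Ketbra.
Variables (n : nat) (e e' : 'I_n -> V).

Definition ketbra_fun x := \sum_i f x (e i) *: e' i.

Fact ketbra_is_linear : linear ketbra_fun.
Proof.
move=> a u w; rewrite /ketbra_fun scaler_sumr -big_split /=.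
by apply: eq_bigr => i _; rewrite linearPl /= scalerDl scalerA.
Qed.
HB.instance Definition _ := GRing.isLinear.Build _ _ _ _ _ ketbra_is_linear.

(* [\sum_i |e' i><e i|] *)
Definition ketbra : 'End(V) := linfun ketbra_fun.

Lemma ketbraE x : ketbra x = \sum_i f x (e i) *: e' i.
Proof. by rewrite lfunE. Qed.

Lemma ketbra_fam j : onfam e -> ketbra (e j) = e' j.
Proof.
move=> oe; rewrite ketbraE (bigD1 j) //= oe eqxx scale1r big1 ?addr0 // => i ij.
by rewrite oe eq_sym (negPf ij) scale0r.
Qed.

End Ketbra.

Lemma adjoint_ketbra n (e e' : 'I_n -> V) : adj (ketbra e e') = ketbra e' e.
Proof.
apply: adjointE => x y; rewrite !ketbraE linear_sumlz linear_sumr.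
apply: eq_bigr => i _; rewrite linearZl_LR linearZr_LR /= (dotC y) conjCK.
by rewrite mulrC.
Qed.

(** Orthonormality contracts the middle family. Applied to bases of two ranges, this one rule gives
    idempotence of projections and all the identities of a partial isometry. *)
Lemma ketbra_comp n (e e' e'' : 'I_n -> V) : onfam e' ->
  (ketbra e' e'' \o ketbra e e')%VF = ketbra e e''.
Proof.
move=> oe; apply/lfunP => x; rewrite comp_lfunE [ketbra e _ x]ketbraE.
rewrite linear_sum ketbraE /=; apply: eq_bigr => i _.
by rewrite linearZ /= ketbra_fam.
Qed.

Lemma orthoproj_ketbra n (e : 'I_n -> V) : onfam e -> orthoproj f (ketbra e e).
Proof. by move=> oe; split; [exact: ketbra_comp | exact: adjoint_ketbra]. Qed.

(** * Ranges, ranks and sums of orthogonal projections *)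

Lemma limgP A x : reflect (exists y, x = A y) (x \in limg A).
Proof.
apply: (iffP memv_imgP) => [[y _ ->]|[y ->]]; first by exists y.
by exists y; rewrite ?memvf.
Qed.

(** An orthonormal list is free, and the [e i] span the range because each is its own image. *)
Lemma op_rank_ketbra n (e : 'I_n -> V) : onfam e -> op_rank (ketbra e e) = n.
Proof.
move=> oe; pose S := [tuple e i | i < n].
have nthS (i : 'I_n) : S`_i = e i by rewrite -tnth_nth tnth_mktuple.
have oS : orthonormal f S.
  apply/orthonormalP; split.
    apply/tuple_uniqP => i j; rewrite !tnth_mktuple => eij.
    have := oe i j; rewrite eij oe eqxx; case: eqP => // _ /eqP.
    by rewrite oner_eq0.
  move=> _ _ /tnthP[i ->] /tnthP[j ->]; rewrite !tnth_mktuple oe; congr (_%:R).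
  case: (i =P j) => [->|ij]; first by rewrite eqxx.
  case: eqP => // eij; have := oe i i.
  rewrite {2}eij oe eqxx; move/eqP/negbTE: ij => -> /eqP.
  by rewrite eq_sym oner_eq0.
have /eqP dimS : \dim <<S>> == n.
  by move: (orthonormal_free oS); rewrite /free size_tuple.
apply: etrans dimS; congr (\dim _).
apply/eqP; rewrite eqEsubv; apply/andP; split.
  apply/subvP => _ /limgP[x ->]; rewrite ketbraE memv_suml // => i _.
  by rewrite memvZ // memv_span // -nthS mem_nth ?size_tuple.
apply/span_subvP => _ /tnthP[i ->]; rewrite tnth_mktuple.
by apply/limgP; exists (e i); rewrite ketbra_fam.
Qed.

Lemma orthoproj_id Q x : orthoproj f Q -> x \in limg Q -> Q x = x.
Proof. by case=> QQ _ /limgP[y ->]; rewrite -comp_lfunE QQ. Qed.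

Lemma onfam_in Q n : (n <= op_rank Q)%N ->
  exists2 e : 'I_n -> V, onfam e & forall i, e i \in limg Q.
Proof.
case/orthonormal_in => S [sS oS SQ]; exists (fun i => S`_i).
  exact: onfam_nth.
by move=> i; rewrite SQ // mem_nth // sS.
Qed.

(** An orthonormal basis [e] of the range determines [Q]: by self-adjointness, the coefficients of
    [Q x] in [e] are [f (Q x) (e i) = f x (Q (e i)) = f x (e i)]. *)
Lemma orthoproj_basis Q n : orthoproj f Q -> op_rank Q = n ->
  exists2 e : 'I_n -> V, onfam e & Q = ketbra e e.
Proof.
move=> oQ <-; have [e oe eQ] := @onfam_in Q _ (leqnn _); exists e => //.
have eqim : limg (ketbra e e) = limg Q.
  apply/eqP; rewrite eqEdim; apply/andP; split; last first.
    exact: eq_leq (esym (op_rank_ketbra oe)).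
  apply/subvP => _ /limgP[x ->]; rewrite ketbraE memv_suml // => i _.
  by rewrite memvZ.
apply/lfunP => x.
rewrite -[LHS](orthoproj_id (orthoproj_ketbra oe)); last first.
  by rewrite eqim memv_img ?memvf.
rewrite !ketbraE; apply: eq_bigr => i _; congr (_ *: _).
by rewrite adjointP; case: (oQ) => _ ->; rewrite (orthoproj_id oQ).
Qed.

Lemma op_rank_eq0 Q : (op_rank Q == 0%N) = (Q == 0).
Proof.
rewrite dimv_eq0; apply/eqP/eqP => [Q0|->]; last first.
  apply/eqP; rewrite -subv0; apply/subvP => _ /limgP[x ->].
  by rewrite zero_lfunE mem0v.
apply/lfunP => x; rewrite zero_lfunE; apply/eqP.
by rewrite -memv0 -Q0 memv_img ?memvf.
Qed.

Lemma op_rank1 : op_rank (\1%VF : 'End(V)) = \dim {:V}.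
Proof. by rewrite /op_rank lim1g. Qed.

(** Orthogonality makes the range of the sum the direct sum of the two ranges. *)
Lemma op_rankD Q Q' : orthoproj f Q -> orthoproj f Q' -> (Q \o Q' = 0)%VF ->
  (Q' \o Q = 0)%VF -> op_rank (Q + Q') = (op_rank Q + op_rank Q')%N.
Proof.
move=> oQ oQ' QQ' Q'Q; rewrite /op_rank -dimv_disjoint_sum; last first.
  apply/eqP; rewrite -subv0; apply/subvP => x.
  rewrite memv_cap => /andP[xQ xQ'].
  (* A common vector satisfies [x = Q (Q' x) = 0]. *)
  rewrite -(orthoproj_id oQ xQ) -(orthoproj_id oQ' xQ') -comp_lfunE QQ'.
  by rewrite zero_lfunE mem0v.
congr (\dim _); apply/eqP; rewrite eqEsubv; apply/andP; split.
  apply/subvP => _ /limgP[x ->]; rewrite add_lfunE memv_add //.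
    by apply/limgP; exists x.
  by apply/limgP; exists x.
apply/subvP => _ /memv_addP[_ /limgP[x ->] [_ /limgP[y ->] ->]].
(* The cross terms vanish, so [Q + Q'] fixes this vector. *)
apply/limgP; exists (Q x + Q' y); rewrite add_lfunE !linearD /= -!comp_lfunE.
by rewrite QQ' Q'Q !zero_lfunE add0r addr0; case: oQ => ->; case: oQ' => ->.
Qed.

Lemma orthoproj_comp0 Q Q' : orthoproj f Q -> orthoproj f Q' ->
  (Q \o Q' = 0)%VF -> (Q' \o Q = 0)%VF.
Proof.
move=> [_ aQ] [_ aQ'] QQ'.
by rewrite -aQ -aQ' -adjoint_comp QQ' adjoint0.
Qed.

Lemma orthoprojD Q Q' : orthoproj f Q -> orthoproj f Q' -> (Q \o Q' = 0)%VF ->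
  orthoproj f (Q + Q').
Proof.
move=> oQ oQ' QQ'; have Q'Q := orthoproj_comp0 oQ oQ' QQ'.
case: oQ oQ' => QQ aQ [Q'Q' aQ']; split; last by rewrite adjointD aQ aQ'.
by rewrite comp_lfunDl !comp_lfunDr QQ QQ' Q'Q Q'Q' add0r addr0.
Qed.

(** The last hypothesis says that [ran Q'] lies in [ran Q]. Its adjoint is [Q' \o Q = Q'], and the
    two relations make [Q - Q'] idempotent. *)
Lemma orthoprojB Q Q' : orthoproj f Q -> orthoproj f Q' -> (Q \o Q' = Q')%VF ->
  orthoproj f (Q - Q').
Proof.
move=> oQ oQ' QQ'; have Q'Q : (Q' \o Q = Q')%VF.
  by case: oQ oQ' => [_ aQ] [_ aQ']; rewrite -{1}aQ -{1}aQ' -adjoint_comp QQ'.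
case: oQ oQ' => QQ aQ [Q'Q' aQ']; split; last first.
  by rewrite adjointD adjointN aQ aQ'.
rewrite comp_lfunDl !comp_lfunDr !comp_lfunNl !comp_lfunNr.
by rewrite QQ QQ' Q'Q Q'Q' opprK addNr addr0.
Qed.

Lemma orthoproj1 : orthoproj f (\1%VF : 'End(V)).
Proof. by split; rewrite ?comp_lfun1l ?adjoint1. Qed.

Lemma orthoproj0 : orthoproj f 0.
Proof. by split; rewrite ?comp_lfun0l ?adjoint0. Qed.

(** * Lists of orthogonal projections with a prescribed sum *)

(** A measurement as a duplicate-free list, with an arbitrary sum [A] in place of the identity:
    lists allow matching by position, and a free [A] allows induction by splitting off the head. *)
Definition resolution s A :=
  [/\ uniq s,
      forall Q, Q \in s -> orthoproj f Q /\ Q <> 0,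
      forall Q Q', Q \in s -> Q' \in s -> Q <> Q' -> (Q \o Q')%VF = 0 &
      \sum_(Q <- s) Q = A].

Lemma resolution_perm s t A : perm_eq s t -> resolution s A -> resolution t A.
Proof.
move=> st [us os ds Ss]; have mst := perm_mem st; split.
- by rewrite -(perm_uniq st).
- by move=> Q; rewrite -mst; apply: os.
- by move=> Q Q'; rewrite -!mst; apply: ds.
- by rewrite -(perm_big _ st).
Qed.

Lemma resolution_measurements M : resolution M \1%VF <-> measurements f M.
Proof. by split=> [[]|[oM dM SM]] //; split=> //; apply: fset_uniq. Qed.

Lemma resolution_cons Q s A : orthoproj f Q -> Q <> 0 ->
  (forall Q', Q' \in s -> (Q \o Q')%VF = 0) -> resolution s (A - Q) ->
  resolution (Q :: s) A.
Proof.
move=> oQ Q0 dQ [us os ds Ss]; split.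
(* A repeated [Q] would satisfy [Q = Q \o Q = 0]. *)
- rewrite /= us andbT; apply/negP => Qs; apply: Q0.
  by case: oQ => <- _; apply: dQ.
- by move=> Q'; rewrite inE => /orP[/eqP->|/os].
- move=> Q1 Q2; rewrite !inE => /orP[/eqP->|Q1s] /orP[/eqP->|Q2s] //.
  + by move=> _; apply: dQ.
  + by move=> _; apply: (orthoproj_comp0 oQ); [case: (os _ Q1s) | apply: dQ].
  + exact: ds.
- by rewrite big_cons Ss addrC subrK.
Qed.

Lemma resolution_behead Q s A : resolution (Q :: s) A ->
  [/\ orthoproj f Q, Q <> 0, forall Q', Q' \in s -> (Q \o Q')%VF = 0 &
      resolution s (A - Q)].
Proof.
case=> /andP[Qs us] os ds Ss; have [oQ Q0] := os Q (mem_head _ _); split=> //.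
- move=> Q' Q's; apply: ds; rewrite ?mem_head // ?inE ?Q's ?orbT //.
  by move=> QQ'; rewrite QQ' Q's in Qs.
- split=> //.
  + by move=> Q' Q's; apply: os; rewrite inE Q's orbT.
  + by move=> Q1 Q2 Q1s Q2s; apply: ds; rewrite inE ?Q1s ?Q2s orbT.
  + by rewrite -Ss big_cons addrAC subrr add0r.
Qed.

(** Induction on the list: the head is orthogonal to the sum of the tail, so their sum is again a
    projection and the ranks add. *)
Lemma resolution_orthoproj s A : resolution s A ->
  orthoproj f A /\ op_rank A = sumn [seq op_rank Q | Q <- s].
Proof.
elim: s A => [|Q s IHs] A.
  case=> _ _ _ <-; rewrite big_nil; split; first exact: orthoproj0.
  by apply/eqP; rewrite op_rank_eq0.
case/resolution_behead => oQ _ dQ rs; have [oA rA] := IHs _ rs.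
have QA : (Q \o (A - Q))%VF = 0.
  by have [_ _ _ <-] := rs; rewrite comp_lfun_sumr big_seq big1.
have -> : A = Q + (A - Q) by rewrite addrC subrK.
split; first exact: orthoprojD.
by rewrite op_rankD ?rA // (orthoproj_comp0 oQ).
Qed.

(** Every term of the sum [A] other than [Q] is annihilated by composition with [Q]. *)
Lemma resolution_absorb s A Q : resolution s A -> Q \in s -> (A \o Q)%VF = Q.
Proof.
move=> [us os ds <-] Qs; have [[QQ _] _] := os _ Qs.
rewrite comp_lfun_suml (bigD1_seq Q) //= big_seq_cond big1 ?addr0 //.
by move=> Q1 /andP[Q1s /eqP Q1Q]; apply: ds.
Qed.

(** Induction on the parts: split off the projection [Q] onto the span of [r] orthonormal vectors of
    [ran A], then resolve [A - Q], whose rank is the sum of the other parts. Nonzero parts give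
    nonzero projections. *)
Lemma resolution_exists lam A : orthoproj f A -> op_rank A = sumn lam ->
  0%N \notin lam -> exists2 s, resolution s A & [seq op_rank Q | Q <- s] = lam.
Proof.
elim: lam A => [|r lam IHlam] A oA rA.
  move=> _; exists [::] => //; split=> //; rewrite big_nil.
  by apply/esym/eqP; rewrite -op_rank_eq0 rA.
rewrite inE negb_or => /andP[r0 lam0].
have [|e oe eA] := @onfam_in A r; first by rewrite rA /= leq_addr.
pose Q := ketbra e e; have oQ : orthoproj f Q := orthoproj_ketbra oe.
have rQ : op_rank Q = r := op_rank_ketbra oe.
have AQ : (A \o Q = Q)%VF.
  apply/lfunP => x; rewrite comp_lfunE ketbraE linear_sum.
  apply: eq_bigr => i _.
  by rewrite linearZ /= (orthoproj_id oA).
have oAQ : orthoproj f (A - Q) := orthoprojB oA oQ AQ.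
have dAQ : ((A - Q) \o Q = 0)%VF.
  by rewrite comp_lfunDl comp_lfunNl AQ; case: oQ => -> _; rewrite subrr.
have dQA := orthoproj_comp0 oAQ oQ dAQ.
have rAQ : op_rank (A - Q) = sumn lam.
  apply/eqP; rewrite -(eqn_add2l r) -[X in _ == X]rA -rQ -op_rankD //.
  by rewrite addrC subrK.
have [s rs <-] := IHlam _ oAQ rAQ lam0; exists (Q :: s); last by rewrite /= rQ.
apply: resolution_cons => //.
  by move/eqP; rewrite -op_rank_eq0 rQ eq_sym (negPf r0).
(* Every later [Q'] equals [(A - Q) \o Q'], and [Q \o (A - Q) = 0]. *)
move=> Q' Q's.
by rewrite -(resolution_absorb rs Q's) comp_lfunA dQA comp_lfun0l.
Qed.

(** * Partial isometries and their gluing into a unitary *)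

(** [W] carries an orthonormal basis of [ran Q] to one of [ran Q']. The last clause will make the
    glued unitary the identity on [ran P]. *)
Lemma partial_isometry Q Q' : orthoproj f Q -> orthoproj f Q' ->
  op_rank Q = op_rank Q' ->
  exists W, [/\ (adj W \o W)%VF = Q, (W \o adj W)%VF = Q', (W \o Q)%VF = W,
               (Q' \o W)%VF = W & Q = Q' -> W = Q].
Proof.
(* Two bases of one range chosen separately could give a nontrivial rotation, so for [Q = Q'] the
   witness is the projection itself. *)
move=> oQ oQ' rQQ'; have [->|QQ'] := eqVneq Q Q'.
  by exists Q'; case: oQ' => QQ aQ; rewrite aQ.
have [e oe defQ] := orthoproj_basis oQ rQQ'.
have [e' oe' defQ'] := orthoproj_basis oQ' erefl.
exists (ketbra e e'); rewrite adjoint_ketbra !ketbra_comp //.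
split=> // [||eqQ]; last by rewrite eqQ eqxx in QQ'.
  by rewrite [X in (_ \o X)%VF]defQ ketbra_comp.
by rewrite [X in (X \o _)%VF]defQ' ketbra_comp.
Qed.

Lemma resolution_comp0 s A i j : resolution s A -> (i < size s)%N ->
  (j < size s)%N -> i <> j -> (s`_i \o s`_j)%VF = 0.
Proof.
move=> [us _ ds _] lti ltj ij; apply: ds; rewrite ?mem_nth //.
by move/eqP; rewrite nth_uniq // => /eqP.
Qed.

(** [U] is the sum of partial isometries [W i] from the range of [s_i] to that of [t_i]. Distinct
    initial spaces are orthogonal, and so are distinct final spaces; hence the cross terms of
    [U \o adj U] and [adj U \o U] vanish, while the diagonal terms are the [t_i] and the [s_i],
    which sum to the identity. *)
Lemma unitary_of_resolutions s t : resolution s \1%VF -> resolution t \1%VF ->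
  [seq op_rank Q | Q <- s] = [seq op_rank Q | Q <- t] ->
  exists2 U, unitary f U & forall i, (i < size s)%N ->
    (U \o s`_i \o adj U)%VF = t`_i /\ (s`_i = t`_i -> (U \o s`_i)%VF = s`_i).
Proof.
move=> rs rt rkst.
have sst : size s = size t.
  by rewrite -(size_map (@op_rank _ _) s) rkst size_map.
pose n := size s.
have lts (i : 'I_n) : (i < size s)%N by [].
have ltt (i : 'I_n) : (i < size t)%N by rewrite -sst.
have os (i : 'I_n) : orthoproj f s`_i.
  by case: rs => _ os _ _; case: (os _ (mem_nth 0 (lts i))).
have ot (i : 'I_n) : orthoproj f t`_i.
  by case: rt => _ ot _ _; case: (ot _ (mem_nth 0 (ltt i))).
have Ss : \sum_(i < n) s`_i = \1%VF.
  by case: rs => _ _ _; rewrite (big_nth 0) big_mkord.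
have St : \sum_(i < n) t`_i = \1%VF.
  by case: rt => _ _ _; rewrite (big_nth 0) big_mkord -sst.
have : forall i : 'I_n, exists W,
    [/\ (adj W \o W)%VF = s`_i, (W \o adj W)%VF = t`_i, (W \o s`_i)%VF = W,
        (t`_i \o W)%VF = W & s`_i = t`_i -> W = s`_i].
  move=> i; apply: partial_isometry => //.
  by rewrite -!(nth_map 0 0%N) // rkst.
case/choice => W WP.
have Ws (i j : 'I_n) : i <> j -> (W i \o s`_j)%VF = 0.
  move=> ij; case: (WP i) => _ _ <- _ _.
  rewrite -comp_lfunA (resolution_comp0 rs) ?comp_lfun0r //.
  by move=> /val_inj.
have tW (i j : 'I_n) : i <> j -> (t`_i \o W j)%VF = 0.
  move=> ij; case: (WP j) => _ _ _ <- _.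
  rewrite comp_lfunA (resolution_comp0 rt) ?comp_lfun0l //.
  by move=> /val_inj.
have WaW (i j : 'I_n) : i <> j -> (adj (W i) \o W j)%VF = 0.
  move=> ij; case: (WP i) => _ _ _ <- _.
  rewrite adjoint_comp; case: (ot i) => _ ->.
  by rewrite -comp_lfunA tW // comp_lfun0r.
have WWa (i j : 'I_n) : i <> j -> (W i \o adj (W j))%VF = 0.
  move=> ij; case: (WP j) => _ _ <- _ _.
  rewrite adjoint_comp; case: (os j) => _ ->.
  by rewrite comp_lfunA Ws // comp_lfun0l.
pose U := \sum_i W i.
have Us (i : 'I_n) : (U \o s`_i)%VF = W i.
  rewrite /U comp_lfun_suml (bigD1 i) //= big1 ?addr0; first by case: (WP i).
  by move=> j /eqP ji; rewrite Ws.
have aU : adj U = \sum_i adj (W i) by rewrite adjoint_sum.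
exists U.
  split; rewrite aU /U.
    rewrite comp_lfun_suml -Ss; apply: eq_bigr => i _.
    rewrite comp_lfun_sumr (bigD1 i) //= big1 ?addr0; first by case: (WP i).
    by move=> j /eqP ji; apply: WaW => /esym.
  rewrite comp_lfun_suml -St; apply: eq_bigr => i _.
  rewrite comp_lfun_sumr (bigD1 i) //= big1 ?addr0; first by case: (WP i).
  by move=> j /eqP ji; apply: WWa => /esym.
move=> i lti; rewrite (Us (Ordinal lti)).
split; last by case: (WP (Ordinal lti)).
(* Of [W i \o adj U] only [W i \o adj (W i) = t_i] survives. *)
rewrite aU comp_lfun_sumr (bigD1 (Ordinal lti)) //= big1 ?addr0.
  by case: (WP (Ordinal lti)).
by move=> j /eqP ji; apply: WWa => /esym.
Qed.

(** * Conjugation by unitaries *)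

(** [adj U] is onto and [U] is injective, so neither changes the dimension of the image. *)
Lemma op_rank_conj U Q : unitary f U ->
  op_rank (U \o Q \o adj U)%VF = op_rank Q.
Proof.
case=> aUU UaU.
have kerU : (lker U == 0)%VS.
  apply/lker0P => x y eqU.
  by rewrite -[x]id_lfunE -[y]id_lfunE -aUU !comp_lfunE eqU.
have imaU : limg (adj U) = fullv.
  apply/eqP; rewrite eqEsubv subvf; apply/subvP => x _; apply/limgP.
  by exists (U x); rewrite -comp_lfunE aUU id_lfunE.
rewrite /op_rank !limg_comp imaU limg_dim_eq //.
by rewrite (eqP kerU) capv0.
Qed.

Lemma conj_inj U : unitary f U -> injective (fun Q => U \o Q \o adj U)%VF.
Proof.
case=> aUU _ Q Q' /(congr1 (fun A => adj U \o A \o U)%VF).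
by rewrite !comp_lfunA aUU !comp_lfun1l -!comp_lfunA aUU !comp_lfun1r.
Qed.

Lemma conj_measurements U M : unitary f U -> measurements f M ->
  measurements f (conj_family f U M).
Proof.
move=> uU [oM dM SM]; have [aUU UaU] := uU.
have cc A B : ((U \o A \o adj U) \o (U \o B \o adj U))%VF
    = (U \o (A \o B) \o adj U)%VF.
  by rewrite !comp_lfunA -[(_ \o adj U \o U)%VF]comp_lfunA aUU comp_lfun1r.
split.
- move=> _ /imfsetP[Q /= QM ->]; have [[QQ aQ] Q0] := oM _ QM; split.
    split; first by rewrite cc QQ.
    by rewrite !adjoint_comp adjointK aQ comp_lfunA.
  by move=> /eqP; rewrite -op_rank_eq0 op_rank_conj // op_rank_eq0 => /eqP.
- move=> _ _ /imfsetP[Q /= QM ->] /imfsetP[Q' /= Q'M ->] QQ'.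
  rewrite cc (dM Q Q') ?comp_lfun0r ?comp_lfun0l // => eqQ.
  by apply: QQ'; rewrite eqQ.
(* Injectivity of conjugation keeps the outcomes distinct, so no term of the sum is lost in the
   image set. *)
- rewrite big_imfset /=; last by move=> x y _ _; apply: conj_inj.
  by rewrite -comp_lfun_suml -comp_lfun_sumr SM comp_lfun1r.
Qed.

(** [U \o P = P] because [U] fixes [ran P], and taking adjoints gives [P \o adj U = P]. *)
Lemma conj_comp_unitary U P : comp_unitary f P U -> orthoproj f P ->
  (U \o P \o adj U)%VF = P.
Proof.
case=> uU fixU [PP aP].
have UP : (U \o P)%VF = P.
  by apply/lfunP => x; rewrite comp_lfunE fixU // memv_img ?memvf.
by rewrite UP -[LHS]adjointK adjoint_comp adjointK aP UP aP.
Qed.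

Lemma conj_measurements_at P U M : orthoproj f P -> comp_unitary f P U ->
  measurements_at f P M -> measurements_at f P (conj_family f U M).
Proof.
move=> oP uU [mM PM]; split; first by apply: conj_measurements => //; case: uU.
by apply/imfsetP; exists P => //=; rewrite (conj_comp_unitary uU oP).
Qed.

(** Conjugation is injective, fixes [P] and preserves ranks, so it matches the outcomes other than
    [P] of the two measurements; sorting removes the dependence on their order. *)
Lemma rank_profile_conj P U M : orthoproj f P -> comp_unitary f P U ->
  rank_profile P (conj_family f U M) = rank_profile P M.
Proof.
move=> oP uUP; have [uU _] := uUP; have cP := conj_comp_unitary uUP oP.
apply/perm_sortP; [exact: leq_total|exact: leq_trans|exact: anti_leq|].
suff pm : perm_eq (enum_fset (conj_family f U M `\ P)%fset)
    [seq (U \o Q \o adj U)%VF | Q <- (M `\ P)%fset].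
  rewrite (permPl (perm_map _ pm)) -map_comp.
  rewrite [X in perm_eq X _](@eq_map _ _ _ (@op_rank C V)) => [|Q].
    exact: perm_refl.
  exact: op_rank_conj.
apply: uniq_perm; rewrite ?fset_uniq // ?map_inj_uniq ?fset_uniq //.
  exact: conj_inj.
move=> Q; rewrite !inE; apply/andP/mapP.
  case=> QP /imfsetP[Q' /= Q'M defQ]; exists Q' => //; rewrite !inE Q'M andbT.
  by apply: contra_neq QP => eqQ; rewrite defQ eqQ cP.
case=> Q' /[!inE] /andP[Q'P Q'M] ->; split; last by apply/imfsetP; exists Q'.
by apply: contra_neq Q'P; rewrite -{1}cP; apply: conj_inj.
Qed.

(** * Rank profiles as a complete invariant *)

Lemma perm_measurement P M : P \in M ->
  perm_eq (P :: enum_fset (M `\ P)%fset) M.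
Proof.
move=> PM; apply: uniq_perm => [||Q].
- by rewrite /= fset_uniq andbT !inE eqxx.
- exact: fset_uniq.
- by rewrite !inE; case: eqVneq => [->|].
Qed.

(* Sorting [M `\ P] and [N `\ P] by rank aligns the two families. *)
Lemma conj_of_rank_profile P M N : measurements_at f P M ->
  measurements_at f P N -> rank_profile P M = rank_profile P N ->
  exists2 U, comp_unitary f P U & conj_family f U M = N.
Proof.
move=> [mM PM] [mN PN]; rewrite /rank_profile !sort_map.
set s := sort _ _; set t := sort _ _ => rkst.
have psM : perm_eq (P :: s) M.
  by rewrite -(permPr (perm_measurement PM)) perm_cons perm_sort.
have ptN : perm_eq (P :: t) N.
  by rewrite -(permPr (perm_measurement PN)) perm_cons perm_sort.
have rs : resolution (P :: s) \1%VF.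
  apply: resolution_perm (proj2 (resolution_measurements M) mM).
  by rewrite perm_sym.
have rt : resolution (P :: t) \1%VF.
  apply: resolution_perm (proj2 (resolution_measurements N) mN).
  by rewrite perm_sym.
have [|U uU UP] := unitary_of_resolutions rs rt; first by rewrite /= rkst.
have sst : size s = size t.
  by rewrite -(size_map (@op_rank _ _) s) rkst size_map.
exists U.
  (* Position 0 holds [P] in both lists, so the equality clause gives [U \o P = P]. *)
  split=> // x xP; have [_ /(_ erefl) /= UPP] := UP 0%N isT.
  have oP : orthoproj f P by case: mM => /(_ _ PM) [].
  by rewrite -(orthoproj_id oP xP) -comp_lfunE UPP.
have cst : [seq (U \o Q \o adj U)%VF | Q <- P :: s] = P :: t.
  apply: (@eq_from_nth _ 0) => [|i]; first by rewrite size_map /= sst.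
  by rewrite size_map => lti; rewrite (nth_map 0) //; case: (UP i lti).
apply/fsetP => Q; rewrite -(perm_mem ptN) -cst.
apply/imfsetP/mapP => -[Q' /= Q'M ->]; exists Q' => //=.
  by rewrite (perm_mem psM).
by rewrite -(perm_mem psM).
Qed.

Lemma rank_profile_partition P M : measurements_at f P M ->
  integer_partitions (\dim {:V} - op_rank P)%N (rank_profile P M).
Proof.
move=> [mM PM].
have rM : resolution (P :: enum_fset (M `\ P)%fset) \1%VF.
  apply: resolution_perm (proj2 (resolution_measurements M) mM).
  by rewrite perm_sym perm_measurement.
split; first exact: (sort_sorted leq_total).
  rewrite mem_sort; apply/negP => /mapP[Q QM /esym /eqP].
  rewrite op_rank_eq0 => /eqP Q0; case: mM => /(_ Q) oM _ _.
  by case: oM => //; move: QM; rewrite !inE => /andP[].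
(* The ranks of all outcomes sum to the dimension; removing the head [P] leaves the required
   total. *)
have [_] := resolution_orthoproj rM; rewrite op_rank1 /= => ->.
by rewrite addKn; apply: perm_sumn; rewrite perm_sort.
Qed.

(** Resolve [\1 - P] into projections of ranks [lam] and adjoin [P], which is orthogonal to each of
    them. *)
Lemma measurements_profile_nonempty P lam : orthoproj f P -> P <> 0 ->
  integer_partitions (\dim {:V} - op_rank P)%N lam ->
  measurements_profile f P lam !=set0.
Proof.
move=> oP P0 [slam lam0 Slam].
have oQ : orthoproj f (\1%VF - P).
  by apply: orthoprojB orthoproj1 oP _; rewrite comp_lfun1l.
have QP : ((\1%VF - P) \o P)%VF = 0.
  rewrite comp_lfunDl comp_lfunNl comp_lfun1l; case: oP => -> _.
  by rewrite subrr.
have PQ := orthoproj_comp0 oQ oP QP.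
have rQ : op_rank (\1%VF - P) = sumn lam.
  rewrite Slam -op_rank1 -[X in (op_rank X - _)%N](subrK P).
  by rewrite (op_rankD oQ oP) // addnK.
have [s rs rks] := resolution_exists oQ rQ lam0.
have rPs : resolution (P :: s) \1%VF.
  apply: resolution_cons => // Q Qs.
  by rewrite -(resolution_absorb rs Qs) comp_lfunA PQ comp_lfun0l.
pose M := [fset Q in P :: s]%fset.
have pM : perm_eq (P :: s) M.
  apply: uniq_perm => [||Q]; [by case: rPs|exact: fset_uniq|by rewrite !inE].
have PM : P \in M by rewrite -(perm_mem pM) mem_head.
exists M; split.
  split=> //; apply/resolution_measurements; exact: resolution_perm rPs.
(* As [lam] is already sorted, it is the sorted list of the ranks in [s]. *)
rewrite -(sorted_sort leq_trans slam) -rks.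
apply/perm_sortP; [exact: leq_total|exact: leq_trans|exact: anti_leq|].
apply: perm_map; rewrite -(perm_cons P).
by rewrite (permPl (perm_measurement PM)) perm_sym.
Qed.

(** One inclusion is invariance of the profile, the other is transitivity on measurements of equal
    profile. *)
Lemma orbit_ofE P M : orthoproj f P -> measurements_at f P M ->
  orbit_of f P M = measurements_profile f P (rank_profile P M).
Proof.
move=> oP mM; apply/seteqP; split => [_ [U uU <-]|N [mN rN]].
  by split; [exact: conj_measurements_at | exact: rank_profile_conj].
by have [U uU UM] := conj_of_rank_profile mM mN (esym rN); exists U.
Qed.

End HilbertTheory.

(** * Orbits indexed by integer partitions, over the complex numbers *)

Local Open Scope complex_scope.

Theorem theorem3p1 (R : realType) (V : vectType R[i]) (f : {dot V for conjC})
    (P : 'End(V)) :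
  (2 <= \dim {:V})%N -> orthoproj f P -> P <> 0 ->
  [/\ forall M N : {fset 'End(V)},
        measurements_at f P M -> measurements_at f P N ->
        (exists2 U, comp_unitary f P U & conj_family f U M = N) <->
        rank_profile P M = rank_profile P N,
      forall lam : seq nat,
        measurements_profile f P lam !=set0 ->
        orbits f P (measurements_profile f P lam) &
      set_bij (integer_partitions (\dim {:V} - op_rank P)%N) (orbits f P)
        (measurements_profile f P)].
Proof.
move=> _ oP P0.
have orb lam : measurements_profile f P lam !=set0 ->
    orbits f P (measurements_profile f P lam).
  by case=> M [mM <-]; exists M => //; apply: orbit_ofE.
split=> //.
  move=> M N mM mN; split; last exact: conj_of_rank_profile.
  by case=> U uU <-; rewrite rank_profile_conj.
split.
- by move=> lam plam; apply: orb; apply: measurements_profile_nonempty.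
(* Injectivity: some measurement has profile [lam] and, the two sets being equal, it also has
   profile [mu]. *)
- move=> lam mu /set_mem plam _ eqm.
  have [M MP] := measurements_profile_nonempty oP P0 plam.
  by have := MP; rewrite eqm => -[_ <-]; case: MP.
- move=> _ [M mM <-]; exists (rank_profile P M).
    exact: rank_profile_partition mM.
  by rewrite orbit_ofE.
Qed.
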